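(* Let $\lambda,\mu,\nu$ be partitions of the same integer with $\ell(\lambda)\le 4$, $\ell(\mu),\ell(\nu)\le 2$, and $\mu_2\ge\nu_2$. Let $$P_\lambda(x,y)=y^{\lambda_3+\lambda_4}\big(x^{\lambda_2+\lambda_4}-x^{\lambda_2+\lambda_3+1}-x^{\lambda_1+\lambda_4+1}+x^{\lambda_1+\lambda_3+2}\big)+y^{\lambda_2+\lambda_4+1}\big(-x^{\lambda_3+\lambda_4-1}+x^{\lambda_2+\lambda_3+1}+x^{\lambda_1+\lambda_4+1}\big).$$ Then: (1) The Kronecker coefficient $g_{\mu,\nu,\lambda}$ equals the coefficient of $x^{\mu_2}y^{\nu_2}$ in the Laurent series $P_\lambda(x,y)\bar F_{2,2}(x,y)$. Moreover, a monomial $y^bx^a$ of $P_\lambda$ contributes a nonzero amount to this coefficient (i.e. the coefficient of $x^{\mu_2-a}y^{\nu_2-b}$ in $\bar F_{2,2}$ is nonzero) if and only if $b\le\nu_2$ and $a+b\le\mu_2+\nu_2$. (2) Explicitly, \begin{align*} g_{\mu,\nu,\lambda}=\;& p_S(\nu_2-(\lambda_3+\lambda_4),\ \nu_2-(\lambda_3+\lambda_4)+\mu_2-(\lambda_2+\lambda_4))\\ &-p_S(\nu_2-(\lambda_3+\lambda_4),\ \nu_2-(\lambda_3+\lambda_4)+\mu_2-(\lambda_2+\lambda_3+1))\\ &-p_S(\nu_2-(\lambda_3+\lambda_4),\ \nu_2-(\lambda_3+\lambda_4)+\mu_2-(\lambda_1+\lambda_4+1))\\ &+p_S(\nu_2-(\lambda_3+\lambda_4),\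 \nu_2-(\lambda_3+\lambda_4)+\mu_2-(\lambda_1+\lambda_3+2))\\ &-p_S(\nu_2-(\lambda_2+\lambda_4+1),\ \nu_2-(\lambda_2+\lambda_4+1)+\mu_2-(\lambda_3+\lambda_4-1))\\ &+p_S(\nu_2-(\lambda_2+\lambda_4+1),\ \nu_2-(\lambda_2+\lambda_4+1)+\mu_2-(\lambda_2+\lambda_3+1))\\ &+p_S(\nu_2-(\lambda_2+\lambda_4+1),\ \nu_2-(\lambda_2+\lambda_4+1)+\mu_2-(\lambda_1+\lambda_4+1)). \end{align*}
   Context: Partitions are padded with zero parts. For partitions $\mu,\nu,\lambda$ of the same integer with $\ell(\mu)\le n$, $\ell(\nu)\le m$, $\ell(\lambda)\le nm$, the Kronecker coefficient $g_{\mu,\nu,\lambda}$ is defined by $s_\lambda(x_1y_1,x_1y_2,\dots,x_ny_m)=\sum_{\mu,\nu}g_{\mu,\nu,\lambda}\,s_\mu(x_1,\dots,x_n)s_\nu(y_1,\dots,y_m)$, where $s$ denotes Schur polynomials (here $n=m=2$). $\bar F_{2,2}(x,y)=1/((1-y/x)(1-xy)(1-x)(1-y))$, expanded as a Laurent series in the domain $0<|xy|<|y|<|x|<1$ (each factor $(1-M)^{-1}$ expanded as $\sum_{k\ge0}M^k$). For integers $n,m$, $p_S(n,m)$ is the number of $(x_1,\dots,x_4)\in\mathbb{Z}_{\ge0}^4$ with $x_1+x_3+x_4=n$, $x_2+x_3+2x_4=m$ (zero if $n<0$ or $m<0$); it is the coefficient of $s_0^ns_1^m$ in $1/((1-s_0)(1-s_1)(1-s_0s_1)(1-s_0s_1^2))$.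 *)

(* Defs.v *)
From HB Require Import structures.
From mathcomp Require Import all_boot all_order all_algebra.
Set Implicit Arguments. Unset Strict Implicit. Unset Printing Implicit Defensive.
Import Order.TTheory GRing.Theory Num.Theory.

(* A filling of the diagram of a shape [la] (a weakly decreasing list of
   parts, zero parts allowed) by entries in {1,...,k}; cells are (row, column)
   pairs in 'I_(size la) * 'I_(sumn la) and the value 0 marks "no cell". *)
Definition tabl (k : nat) (la : seq nat) :=
  {ffun 'I_(size la) * 'I_(sumn la) -> 'I_k.+1}.

Definition ssytb (k : nat) (la : seq nat) (T : tabl k la) : bool :=
  [&& [forall i : 'I_(size la), forall j : 'I_(sumn la),
         (j < nth 0 la i) == (T (i, j) != ord0)],
      [forall i : 'I_(size la), forall j : 'I_(sumn la), forall j' : 'I_(sumn la),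
         ((j < j') && (j' < nth 0 la i)) ==> (T (i, j) <= T (i, j'))]
    & [forall i : 'I_(size la), forall i' : 'I_(size la), forall j : 'I_(sumn la),
         ((i < i') && (j < nth 0 la i')) ==> (T (i, j) < T (i', j))]].

Definition cnt (k : nat) (la : seq nat) (T : tabl k la) (v : nat) : nat :=
  #|[set p | val (T p) == v]|.

(* coefficient of x1^a1 x2^a2 in the Schur polynomial s_la(x1,x2)
   (s_la = sum over SSYT T of x^T) *)
Definition schur_coef2 (la : seq nat) (a1 a2 : nat) : nat :=
  #|[set T : tabl 2 la | ssytb T && (cnt T 1 == a1) && (cnt T 2 == a2)]|.

(* coefficient of x1^a1 x2^a2 y1^b1 y2^b2 in
   s_la(z1,z2,z3,z4) with z1=x1y1, z2=x1y2, z3=x2y1, z4=x2y2 *)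
Definition schur_sub4 (la : seq nat) (a1 a2 b1 b2 : nat) : nat :=
  #|[set T : tabl 4 la | [&& ssytb T,
       cnt T 1 + cnt T 2 == a1, cnt T 3 + cnt T 4 == a2,
       cnt T 1 + cnt T 3 == b1 & cnt T 2 + cnt T 4 == b2]]|.

(* g is the family of Kronecker coefficients g_{(m1,m2),(n1,n2),la}:
   s_la(x_i y_j) = sum_{mu,nu} g mu nu s_mu(x1,x2) s_nu(y1,y2),
   compared coefficientwise (only finitely many mu,nu contribute to a
   given monomial, by homogeneity). *)
Definition kron_expansion (la : seq nat) (g : nat -> nat -> nat -> nat -> int) : Prop :=
  forall a1 a2 b1 b2 : nat,
    ((schur_sub4 la a1 a2 b1 b2)%:Z =
     \sum_(m1 < (a1 + a2).+1) \sum_(m2 < (a1 + a2).+1 | (m2 <= m1)%N)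
      \sum_(n1 < (b1 + b2).+1) \sum_(n2 < (b1 + b2).+1 | (n2 <= n1)%N)
        g m1 m2 n1 n2 * (schur_coef2 [:: nat_of_ord m1; nat_of_ord m2] a1 a2
                         * schur_coef2 [:: nat_of_ord n1; nat_of_ord n2] b1 b2)%:Z)%R.

(* coefficient of x^a y^b in Fbar_{2,2} = sum_{k in N^4} (y/x)^k1 (xy)^k2 x^k3 y^k4,
   i.e. #{k in N^4 : -k1+k2+k3 = a, k1+k2+k4 = b}  (bounds are sufficient) *)
Definition Fbar_coef (a b : int) : nat :=
  (\sum_(k1 < (`|b|%N).+1) \sum_(k2 < (`|b|%N).+1) \sum_(k3 < (`|a| + `|b|)%N.+1)
    \sum_(k4 < (`|b|%N).+1)
      nat_of_bool ((- (k1%:Z) + k2%:Z + k3%:Z == a)%R && ((k1 + k2 + k4)%:Z == b)%R))%N.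

Definition pS (n m : int) : nat :=
  if ((n < 0) || (m < 0))%R then 0%N else
  (\sum_(x1 < (`|n| + `|m|)%N.+1) \sum_(x2 < (`|n| + `|m|)%N.+1)
   \sum_(x3 < (`|n| + `|m|)%N.+1) \sum_(x4 < (`|n| + `|m|)%N.+1)
      nat_of_bool (((x1 + x3 + x4)%:Z == n)%R && ((x2 + x3 + 2 * x4)%:Z == m)%R))%N.

Local Open Scope ring_scope.

(* The seven terms c * x^a * y^b of P_lambda, as triples ((c, a), b). *)
Definition P_terms (l1 l2 l3 l4 : nat) : seq (int * int * int) :=
  let e1 : int := (l3 + l4)%N%:Z in
  let e2 : int := (l2 + l4 + 1)%N%:Z in
  [:: (1%R, (l2 + l4)%N%:Z, e1); ((-1)%R, (l2 + l3 + 1)%N%:Z, e1);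
      ((-1)%R, (l1 + l4 + 1)%N%:Z, e1); (1%R, (l1 + l3 + 2)%N%:Z, e1);
      ((-1)%R, (l3%:Z + l4%:Z - 1)%R, e2); (1%R, (l2 + l3 + 1)%N%:Z, e2);
      (1%R, (l1 + l4 + 1)%N%:Z, e2)].

Definition PF_coef (l1 l2 l3 l4 : nat) (a b : int) : int :=
  (\sum_(t <- P_terms l1 l2 l3 l4) t.1.1 * (Fbar_coef (a - t.1.2) (b - t.2))%:Z)%R.

(* Main.v *)
Require Import Defs.
From HB Require Import structures.
From mathcomp Require Import all_boot all_order all_algebra.
From mathcomp Require Import zify ring.
Import Order.TTheory GRing.Theory Num.Theory.

(* Semistandard tableaux are Gelfand-Tsetlin patterns, and summing geometric
   series over interlacing rows shows that s_la(z1,...,z4) times the Vandermonde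
   product is the alternant with exponents la + (3,2,1,0).  At z = (1, y, x, xy)
   the alternant has 24 monomials, and (1-x)(1-y) divided by the Vandermonde
   product is -Fbar_{2,2} / (x^2 y).  Since a two-variable Schur polynomial times
   1-x is a difference of two monomials, g_{mu,nu,la} is the coefficient of
   x^mu2 y^nu2 in (1-x)(1-y) s_la(1,y,x,xy).  Of the 24 monomials, 13 do not
   contribute since the coefficient of x^a y^b in Fbar vanishes unless b >= 0 and
   a + b >= 0, four cancel in pairs since this coefficient does not depend on a
   once a >= b, and the other seven form P_la. *)

Set Implicit Arguments. Unset Strict Implicit. Unset Printing Implicit Defensive.

(** * Semistandard tableaux as Gelfand-Tsetlin patterns *)

Lemma card_ltn_ord m n : m <= n -> #|[set j : 'I_n | j < m]| = m.
Proof.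
by move=> mn; rewrite cardsE -sum1_card (big_ord_narrow mn) sum1_card card_ord.
Qed.

Section Tableaux.
Variables (k : nat) (la : seq nat).
Implicit Types (c : 'I_(size la) -> nat -> nat) (T : tabl k la).

(* [c i v] is the number of cells of row [i] with entry at most [v]. *)
Definition gt_pattern c : Prop :=
  [/\ forall i, c i 0 = 0,
      forall i, c i k = nth 0 la i,
      forall i v, v < k -> c i v <= c i v.+1 &
      forall (i i' : 'I_(size la)) v, i < i' -> v < k -> c i' v.+1 <= c i v].

(** Inverse of [row_count]: as [c i] is weakly increasing, the number of [v < k] with [c i v <= j]
    is the least [u] with [j < c i u], which is the entry of cell [(i, j)]. *)
Definition tabl_of c : tabl k la :=
  [ffun p : 'I_(size la) * 'I_(sumn la) =>
     inord (if p.2 < nth 0 la p.1 then \sum_(v < k) (c p.1 v <= p.2) else 0)].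

Definition row_count T (i : 'I_(size la)) (v : nat) : nat :=
  #|[set j | 0 < T (i, j) <= v]|.

Lemma gt_pattern_mono c i u v :
  gt_pattern c -> u <= v -> v <= k -> c i u <= c i v.
Proof.
case=> _ _ cS _ le_uv; rewrite -(subnK le_uv); elim: (v - u) => [|d IH] ltk //.
by rewrite addSn; apply: leq_trans (cS _ _ _) => //; apply: IH; apply: ltnW.
Qed.

Lemma tabl_ofE c i j : (tabl_of c (i, j) : nat) =
  if j < nth 0 la i then \sum_(v < k) (c i v <= j) else 0.
Proof.
rewrite ffunE /= inordK //; case: ifP => // _; rewrite ltnS.
rewrite -[X in _ <= X]muln1 -[X in _ <= X * 1]card_ord -sum_nat_const.
by apply: leq_sum => v _; apply: leq_b1.
Qed.

(** The sum splits at [v]: if [j < c i v], the terms from [v] on vanish by monotonicity; otherwise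
    the terms up to [v] are all 1, which already gives [v + 1]. *)
Lemma tabl_of_le c (i : 'I_(size la)) (j : 'I_(sumn la)) v :
  gt_pattern c -> j < nth 0 la i -> v <= k ->
  (tabl_of c (i, j) <= v) = (j < c i v).
Proof.
move=> gtc jla vk; rewrite tabl_ofE jla.
rewrite -(big_mkord xpredT (fun v => nat_of_bool (c i v <= j))).
rewrite (big_cat_nat (leq0n v) vk) /=; case: (ltnP j (c i v)) => [lt_j | ge_j].
  rewrite [X in _ + X]big_nat [X in _ + X]big1 ?addn0; last first.
    move=> u /andP[vu uk]; apply/eqP; rewrite eqb0 -ltnNge.
    exact: leq_trans lt_j (gt_pattern_mono i gtc vu (ltnW uk)).
  rewrite -[X in _ <= X]muln1 -{2}(subn0 v) -sum_nat_const_nat.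
  by apply: leq_sum => u _; apply: leq_b1.
have vk' : v < k.
  rewrite ltn_neqAle vk andbT; apply: contraL jla => /eqP vk'.
  by case: gtc => _ ck _ _; rewrite -leqNgt -ck -vk'.
apply/negbTE; rewrite -ltnNge [X in _ < _ + X]big_ltn // ge_j addnCA add1n ltnS.
apply: leq_trans (leq_addr _ _).
rewrite big_nat (eq_bigr (fun=> 1)); last first.
  move=> u /andP[_ uv]; rewrite (leq_trans _ ge_j) //.
  exact: gt_pattern_mono gtc (ltnW uv) vk.
by rewrite -big_nat sum_nat_const_nat subn0 muln1.
Qed.

Lemma tabl_of_gt0 c i j : gt_pattern c ->
  (0 < tabl_of c (i, j)) = (j < nth 0 la i).
Proof.
move=> gtc; case: (ltnP j) => [jla | laj]; last by rewrite tabl_ofE (ltnNge j) laj.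
by rewrite ltnNge tabl_of_le //; case: gtc => -> _ _ _.
Qed.

Lemma ssytb_tabl_of c : gt_pattern c -> ssytb (tabl_of c).
Proof.
move=> gtc; have [_ _ _ cI] := gtc.
apply/and3P; split.
- apply/forallP=> i; apply/forallP=> j.
  by rewrite -(tabl_of_gt0 i j gtc) lt0n.
- apply/forallP=> i; apply/forallP=> j; apply/forallP=> j'.
  apply/implyP=> /andP[jj' j'la].
  have Tk : tabl_of c (i, j') <= k by rewrite -ltnS.
  rewrite (tabl_of_le gtc (ltn_trans jj' j'la) Tk) (ltn_trans jj') //.
  by rewrite -(tabl_of_le gtc).
- apply/forallP=> i; apply/forallP=> i'; apply/forallP=> j.
  apply/implyP=> /andP[ii' jla'].
  have := tabl_of_gt0 i' j gtc; rewrite jla'.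
  case Tv: (nat_of_ord _) => [|v] // _.
  have vk : v < k by rewrite -ltnS -Tv.
  have jc : j < c i v.
    by apply: leq_trans (cI _ _ _ ii' vk); rewrite -(tabl_of_le gtc) // Tv.
  have jla : j < nth 0 la i.
    have [_ <- _ _] := gtc.
    exact: leq_trans jc (gt_pattern_mono i gtc (ltnW vk) (leqnn k)).
  by rewrite ltnS tabl_of_le // ltnW.
Qed.

Lemma leq_nth_sumn (s : seq nat) i : nth 0 s i <= sumn s.
Proof.
elim: s i => [|x s IH] [|i] //=; first exact: leq_addr.
exact: leq_trans (IH i) (leq_addl _ _).
Qed.

Lemma row_count_tabl_of c i v :
  gt_pattern c -> v <= k -> row_count (tabl_of c) i v = c i v.
Proof.
move=> gtc vk; have cla : c i v <= nth 0 la i.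
  by have [_ <- _ _] := gtc; apply: gt_pattern_mono gtc _ _.
have cs : c i v <= sumn la by apply: leq_trans cla (leq_nth_sumn _ _).
rewrite /row_count -[RHS](card_ltn_ord cs).
apply: eq_card => j; rewrite !inE tabl_of_gt0 //.
case: (ltnP j (nth _ _ _)) => [jla | laj]; first by rewrite tabl_of_le.
by rewrite ltnNge (leq_trans cla laj).
Qed.

Lemma cnt_row_count T v : cnt T v.+1 =
  \sum_i (row_count T i v.+1 - row_count T i v).
Proof.
rewrite /cnt -sum1_card.
rewrite (eq_bigl (fun p => xpredT p.1 && (val (T (p.1, p.2)) == v.+1))); last first.
  by move=> [i j]; rewrite inE.
rewrite -(pair_big_dep xpredT (fun i j => val (T (i, j)) == v.+1) (fun _ _ => 1)) /=.
apply: eq_bigr => i _.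
have -> : row_count T i v.+1 =
    row_count T i v + #|[set j | T (i, j) == v.+1 :> nat]|.
  rewrite /row_count -cardsUI [X in _ = _ + #|pred_of_set X|](_ : _ = set0) ?cards0 ?addn0.
    by apply: eq_card => j; rewrite !inE; lia.
  by apply/setP => j; rewrite !inE; lia.
by rewrite addKn -sum1_card; apply: eq_bigl => j; rewrite inE.
Qed.

Lemma cnt_tabl_of c v : gt_pattern c -> v < k ->
  cnt (tabl_of c) v.+1 = \sum_i (c i v.+1 - c i v).
Proof.
move=> gtc vk; rewrite cnt_row_count; apply: eq_bigr => i _.
by rewrite !row_count_tabl_of // ltnW.
Qed.

Hypothesis la_part : forall i i', i <= i' -> nth 0 la i' <= nth 0 la i.

Section RowCount.
Variable T : tabl k la.
Hypothesis ssT : ssytb T.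

Lemma ssytb_gt0 i j : (0 < T (i, j)) = (j < nth 0 la i).
Proof.
by case/and3P: ssT => /forallP/(_ i)/forallP/(_ j)/eqP -> _ _; rewrite lt0n.
Qed.

Lemma ssytb_row (i : 'I_(size la)) (j j' : 'I_(sumn la)) :
  j <= j' -> j' < nth 0 la i -> T (i, j) <= T (i, j').
Proof.
rewrite leq_eqVlt => /orP[/eqP/val_inj -> // | jj' j'la].
case/and3P: ssT => _ /forallP/(_ i)/forallP/(_ j)/forallP/(_ j').
by rewrite jj' j'la.
Qed.

Lemma ssytb_col (i i' : 'I_(size la)) (j : 'I_(sumn la)) :
  i < i' -> j < nth 0 la i' -> T (i, j) < T (i', j).
Proof.
move=> ii' jla; case/and3P: ssT => _ _.
by move=> /forallP/(_ i)/forallP/(_ i')/forallP/(_ j); rewrite ii' jla.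
Qed.

(** Rows increase weakly, so the cells of a row with entry at most [v] form an initial segment. *)
Lemma row_count_gt (i : 'I_(size la)) (j : 'I_(sumn la)) v : j < nth 0 la i ->
  (j < row_count T i v) = (T (i, j) <= v).
Proof.
move=> jla; rewrite /row_count; case: (leqP _ v) => [Tv | vT].
  rewrite -[X in X <= _](card_ltn_ord (ltn_ord j)).
  apply: subset_leq_card; apply/subsetP=> j'; rewrite !inE ltnS => j'j.
  rewrite ssytb_gt0 (leq_ltn_trans j'j) //=.
  exact: leq_trans (ssytb_row j'j jla) Tv.
apply/negbTE; rewrite -leqNgt.
rewrite -[X in _ <= X](card_ltn_ord (ltnW (ltn_ord j))).
apply: subset_leq_card; apply/subsetP=> j'; rewrite !inE ssytb_gt0 => /andP[j'la j'v].
by rewrite ltnNge; apply: contraL j'v => jj'; rewrite -ltnNge (leq_trans vT) ?ssytb_row.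
Qed.

Lemma gt_pattern_row_count : gt_pattern (row_count T).
Proof.
split=> [i|i|i v vk|i i' v ii' vk].
- by apply: eq_card0 => j; rewrite !inE leqn0 lt0n andNb.
- rewrite /row_count -[RHS](card_ltn_ord (leq_nth_sumn la i)).
  by apply: eq_card => j; rewrite !inE ssytb_gt0 -(ltnS _ k) ltn_ord andbT.
- by apply: subset_leq_card; apply/subsetP=> j; rewrite !inE; lia.
(* Column strictness gives interlacing: above a cell with entry at most [v + 1] lies one with entry
   at most [v]. *)
- apply: subset_leq_card; apply/subsetP=> j; rewrite !inE !ssytb_gt0.
  case/andP=> jla' Tv; rewrite (leq_trans jla' (la_part (ltnW ii'))) /=.
  by rewrite -ltnS (leq_trans (ssytb_col ii' jla')).
Qed.

Lemma tabl_of_row_count : tabl_of (row_count T) = T.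
Proof.
apply/ffunP=> -[i j]; apply: val_inj; rewrite /= tabl_ofE.
case: ifP => [jla | /negbT jla]; last by apply/esym/eqP; rewrite -leqn0 leqNgt ssytb_gt0.
under eq_bigr => v _ do rewrite leqNgt row_count_gt // -ltnNge.
have Tk : T (i, j) <= k by rewrite -ltnS.
by rewrite -big_mkcond -[RHS](card_ltn_ord Tk) -sum1_card; apply: eq_bigl => v; rewrite inE.
Qed.

End RowCount.

(** Transfers the count of tableaux to any finite parametrization [c] of the patterns. A pattern is
    a function on all of [nat], but only its values at [v <= k] matter, so agreement is asked only
    there. *)
Lemma card_ssyt (X : finType) (V : pred X) (c : X -> 'I_(size la) -> nat -> nat)
    (Q : pred (tabl k la)) :
    (forall x, V x -> gt_pattern (c x)) ->
    (forall x y, V x -> V y ->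
       (forall i v, v <= k -> c x i v = c y i v) -> x = y) ->
    (forall c', gt_pattern c' ->
       exists2 x, V x & forall i v, v <= k -> c x i v = c' i v) ->
  #|[set T : tabl k la | ssytb T && Q T]| = #|[set x | V x && Q (tabl_of (c x))]|.
Proof.
move=> gtV injV surjV.
rewrite -[RHS](@card_in_imset _ _ (fun x => tabl_of (c x))); last first.
  move=> x y; rewrite !inE => /andP[Vx _] /andP[Vy _] eqT; apply: injV => // i v vk.
  rewrite -(row_count_tabl_of i (gtV _ Vx) vk) eqT.
  by rewrite row_count_tabl_of //; apply: gtV.
apply: eq_card => T; rewrite inE; apply/andP/imsetP => [[ssT QT] | [x]].
  have [x Vx cx] := surjV _ (gt_pattern_row_count ssT).
  have Tx : T = tabl_of (c x).
    rewrite -[LHS]tabl_of_row_count //; apply/ffunP=> p; rewrite !ffunE.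
    congr inord; case: ifP => // _; apply: eq_bigr => v _.
    by rewrite cx // ltnW.
  by exists x => //; rewrite inE Vx -Tx.
by rewrite inE => /andP[Vx Qx] ->; split=> //; apply/ssytb_tabl_of/gtV.
Qed.

End Tableaux.

(** * Schur polynomials by branching and their bialternant formula *)

Section Bialternant.
Local Open Scope ring_scope.
Variable R : comNzRingType.
Implicit Types z w : R.

Definition geom_sum z w (a b : nat) : R :=
  \sum_(b <= p < a.+1) z ^+ p * w ^+ (a - p).

Lemma geom_sumE z w (d b : nat) :
  (z - w) * geom_sum z w (d + b) b = z ^+ b * (z ^+ d.+1 - w ^+ d.+1).
Proof.
rewrite /geom_sum; elim: d => [|d IH].
  by rewrite add0n big_nat1 subnn expr0 !expr1; ring.
rewrite big_nat_recr /=; last lia.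
rewrite (_ : \sum_(b <= p < _) _ = w * \sum_(b <= p < (d + b).+1) z ^+ p * w ^+ (d + b - p)).
  rewrite addSn subnn expr0 mulr1 mulrDr mulrCA IH -addSn exprD !exprS; ring.
rewrite big_distrr /= addSn big_nat [RHS]big_nat; apply: eq_bigr => p /andP[_ lep].
by rewrite subSn; [rewrite exprS mulrCA | lia].
Qed.

(** Here and in [schur3] and [schur4], the branching rule: the last variable records the row lengths
    of the skew shape. Its exponent is kept as a product of powers, one per row, so that the nested
    sums separate. *)
Definition schur2 z1 z2 (p1 p2 : nat) : R :=
  \sum_(p2 <= q < p1.+1) z1 ^+ q * (z2 ^+ (p1 - q) * z2 ^+ p2).

Definition schur3 z1 z2 z3 (k1 k2 k3 : nat) : R :=
  \sum_(k2 <= p1 < k1.+1) \sum_(k3 <= p2 < k2.+1)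
    schur2 z1 z2 p1 p2 * (z3 ^+ (k1 - p1) * z3 ^+ (k2 - p2) * z3 ^+ k3).

Definition schur4 z1 z2 z3 z4 (l1 l2 l3 l4 : nat) : R :=
  \sum_(l2 <= k1 < l1.+1) \sum_(l3 <= k2 < l2.+1) \sum_(l4 <= k3 < l3.+1)
    schur3 z1 z2 z3 k1 k2 k3 *
    (z4 ^+ (l1 - k1) * z4 ^+ (l2 - k2) * z4 ^+ (l3 - k3) * z4 ^+ l4).

(** Alternants, the determinants of the powers z_i^(e_j), expanded along the last variable to match
    the branching rule. *)
Definition alt2 z1 z2 (a b : nat) : R := z1 ^+ a * z2 ^+ b - z1 ^+ b * z2 ^+ a.

Definition alt3 z1 z2 z3 (a b c : nat) : R :=
  alt2 z1 z2 a b * z3 ^+ c - alt2 z1 z2 a c * z3 ^+ b + alt2 z1 z2 b c * z3 ^+ a.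

Definition alt4 z1 z2 z3 z4 (a b c d : nat) : R :=
  alt3 z1 z2 z3 a b c * z4 ^+ d - alt3 z1 z2 z3 a b d * z4 ^+ c
  + alt3 z1 z2 z3 a c d * z4 ^+ b - alt3 z1 z2 z3 b c d * z4 ^+ a.

Lemma alt4E z1 z2 z3 z4 (a b c d : nat) :
  let f p q r t := z1 ^+ p * z2 ^+ q * z3 ^+ r * z4 ^+ t in
  alt4 z1 z2 z3 z4 a b c d =
  f a b c d - f a b d c - f a c b d + f a c d b + f a d b c - f a d c b - f b
  a c d + f b a d c + f b c a d - f b c d a - f b d a c + f b d c a + f c a b
  d - f c a d b - f c b a d + f c b d a + f c d a b - f c d b a - f d a b c +
  f d a c b + f d b a c - f d b c a - f d c a b + f d c b a.
Proof. by rewrite /alt4 /alt3 /alt2; ring. Qed.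

Lemma schur2_alt z1 z2 (p1 p2 : nat) : (p2 <= p1)%N ->
  (z1 - z2) * schur2 z1 z2 p1 p2 = alt2 z1 z2 p1.+1 p2.
Proof.
move=> /subnK <-; move: (p1 - p2)%N => d; rewrite /schur2.
under eq_bigr => q _ do rewrite mulrA.
rewrite -big_distrl /= mulrA geom_sumE /alt2 -addSn !exprD; ring.
Qed.

Lemma sum_prod2 (F G : nat -> R) a b c d :
  \sum_(a <= i < b) \sum_(c <= j < d) F i * G j =
  (\sum_(a <= i < b) F i) * (\sum_(c <= j < d) G j).
Proof.
by rewrite big_distrl; apply: eq_bigr => i _; rewrite big_distrr.
Qed.

(** By [schur2_alt], the factor [z1 - z2] makes the summand a difference of two products, each of a
    function of [p1] and a function of [p2]. The double sum becomes products of geometric sums,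
    which the factors [z1 - z3] and [z2 - z3] evaluate. *)
Lemma schur3_alt z1 z2 z3 (k1 k2 k3 : nat) : (k2 <= k1)%N -> (k3 <= k2)%N ->
  (z1 - z2) * (z1 - z3) * (z2 - z3) * schur3 z1 z2 z3 k1 k2 k3 =
  alt3 z1 z2 z3 k1.+2 k2.+1 k3.
Proof.
move=> le21 le32.
have E : (z1 - z2) * schur3 z1 z2 z3 k1 k2 k3 =
    (z1 * (geom_sum z1 z3 k1 k2 * geom_sum z2 z3 k2 k3)
     - z2 * (geom_sum z2 z3 k1 k2 * geom_sum z1 z3 k2 k3)) * z3 ^+ k3.
  rewrite /geom_sum -!sum_prod2 !big_distrr /= -sumrB big_distrl /=.
  rewrite big_nat [RHS]big_nat; apply: eq_bigr => p1 /andP[lep1 _].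
  rewrite !big_distrr /= -sumrB big_distrl /=.
  rewrite big_nat [RHS]big_nat; apply: eq_bigr => p2 /andP[_ lep2].
  rewrite mulrA schur2_alt /alt2; last lia.
  by rewrite exprS (exprS z2); ring.
move: E; rewrite -(subnK le21); move: (k1 - k2)%N => d.
rewrite -(subnK le32); move: (k2 - k3)%N => e E.
transitivity ((z1 * ((z1 - z3) * geom_sum z1 z3 (d + (e + k3)) (e + k3)
                    * ((z2 - z3) * geom_sum z2 z3 (e + k3) k3))
   - z2 * ((z2 - z3) * geom_sum z2 z3 (d + (e + k3)) (e + k3)
          * ((z1 - z3) * geom_sum z1 z3 (e + k3) k3))) * z3 ^+ k3).
  rewrite (_ : _ * (z2 - z3) = (z1 - z3) * (z2 - z3) * (z1 - z2)); last by ring.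
  by rewrite -mulrA E; ring.
rewrite !geom_sumE /alt3 /alt2 !(exprS, exprD); ring.
Qed.

Lemma sum_prod3 (F G H : nat -> R) a b c d e f :
  \sum_(a <= i < b) \sum_(c <= j < d) \sum_(e <= k < f) F i * G j * H k =
  (\sum_(a <= i < b) F i) * (\sum_(c <= j < d) G j) * (\sum_(e <= k < f) H k).
Proof.
rewrite -sum_prod2 big_distrl; apply: eq_bigr => i _.
rewrite big_distrl; apply: eq_bigr => j _; by rewrite big_distrr.
Qed.

(** The same step one variable up: the six terms of [alt3] give six triples of geometric sums, each
    with one sum in each of [z1], [z2], [z3], so that the three factors with [z4] evaluate all of
    them. *)
Lemma schur4_alt z1 z2 z3 z4 (l1 l2 l3 l4 : nat) :
  (l2 <= l1)%N -> (l3 <= l2)%N -> (l4 <= l3)%N ->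
  (z1 - z2) * (z1 - z3) * (z2 - z3) * (z1 - z4) * (z2 - z4) * (z3 - z4)
    * schur4 z1 z2 z3 z4 l1 l2 l3 l4 =
  alt4 z1 z2 z3 z4 l1.+3 l2.+2 l3.+1 l4.
Proof.
move=> le21 le32 le43.
have E : (z1 - z2) * (z1 - z3) * (z2 - z3) * schur4 z1 z2 z3 z4 l1 l2 l3 l4 =
   let g1 z := geom_sum z z4 l1 l2 in let g2 z := geom_sum z z4 l2 l3 in
   let g3 z := geom_sum z z4 l3 l4 in
   (z1 ^+ 2 * z2 * (g1 z1 * g2 z2 * g3 z3) - z2 ^+ 2 * z1 * (g1 z2 * g2 z1 * g3 z3)
   - z1 ^+ 2 * z3 * (g1 z1 * g2 z3 * g3 z2) + z2 ^+ 2 * z3 * (g1 z2 * g2 z3 * g3 z1)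
   + z3 ^+ 2 * z1 * (g1 z3 * g2 z1 * g3 z2) - z3 ^+ 2 * z2 * (g1 z3 * g2 z2 * g3 z1))
   * z4 ^+ l4.
  rewrite /= /geom_sum -!sum_prod3 !big_distrr /= -!sumrN -!big_split big_distrl /=.
  rewrite big_nat [RHS]big_nat; apply: eq_bigr => k1 /andP[lek1 _].
  rewrite !big_distrr /= -!sumrN -!big_split big_distrl /=.
  rewrite big_nat [RHS]big_nat; apply: eq_bigr => k2 /andP[lek2 ltk2].
  rewrite !big_distrr /= -!sumrN -!big_split big_distrl /=.
  rewrite big_nat [RHS]big_nat; apply: eq_bigr => k3 /andP[_ lek3].
  rewrite mulrA schur3_alt /alt3 /alt2; [|lia..].
  by rewrite !exprS !expr0; ring.
move: E; rewrite -(subnK le21); move: (l1 - l2)%N => a.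
rewrite -(subnK le32); move: (l2 - l3)%N => b.
rewrite -(subnK le43); move: (l3 - l4)%N => c /= E.
transitivity (
   let g1 z := (z - z4) * geom_sum z z4 (a + (b + (c + l4))) (b + (c + l4)) in
   let g2 z := (z - z4) * geom_sum z z4 (b + (c + l4)) (c + l4) in
   let g3 z := (z - z4) * geom_sum z z4 (c + l4) l4 in
   (z1 ^+ 2 * z2 * (g1 z1 * g2 z2 * g3 z3) - z2 ^+ 2 * z1 * (g1 z2 * g2 z1 * g3 z3)
   - z1 ^+ 2 * z3 * (g1 z1 * g2 z3 * g3 z2) + z2 ^+ 2 * z3 * (g1 z2 * g2 z3 * g3 z1)
   + z3 ^+ 2 * z1 * (g1 z3 * g2 z1 * g3 z2) - z3 ^+ 2 * z2 * (g1 z3 * g2 z2 * g3 z1))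
   * z4 ^+ l4).
  set V := (X in X * schur4 _ _ _ _ _ _ _ _ = _).
  have -> : V = (z1 - z4) * (z2 - z4) * (z3 - z4) * ((z1 - z2) * (z1 - z3) * (z2 - z3)).
    by rewrite /V; ring.
  by rewrite -mulrA E /=; ring.
rewrite /= !geom_sumE /alt4 /alt3 /alt2 !(exprS, exprD, expr0); ring.
Qed.

End Bialternant.

(** * Pattern parametrizations for two and four rows *)

(** The only free entry of a two-row pattern is [q], the number of ones in the first row, and the
    content forces [q = a1]. *)
Lemma schur_coef2E (m1 m2 a1 a2 : nat) : m2 <= m1 ->
  schur_coef2 [:: m1; m2] a1 a2 = (a1 + a2 == m1 + m2) && (m2 <= a1 <= m1).
Proof.
move=> le21; pose la := [:: m1; m2].
pose c (q : 'I_m1.+1) (i : 'I_(size la)) (v : nat) : nat :=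
  nth 0 (nth [::] [:: [:: 0; val q; m1]; [:: 0; 0; m2]] i) v.
pose i0 := @Ordinal (size la) 0 isT; pose i1 := @Ordinal (size la) 1 isT.
have gtc (q : 'I_m1.+1) : m2 <= q -> gt_pattern 2 (c q).
  move=> m2q; have := ltn_ord q; rewrite ltnS => qm1; split; rewrite /c.
  - by case=> -[|[|i]].
  - by case=> -[|[|i]].
  - by case=> -[|[|i]] ? [|[|v]].
  - by case=> -[|[|i]] ? [[|[|i']] ?] [|[|v]].
have part (i i' : nat) : i <= i' -> nth 0 la i' <= nth 0 la i.
  by case: i i' => [|[|i]] [|[|i']] //=; rewrite nth_nil.
rewrite /schur_coef2.
under eq_finset do rewrite -andbA.
rewrite (card_ssyt part (V := fun q : 'I_m1.+1 => m2 <= q) (c := c)) //; first last.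
- move=> c' [c0 ck cS cI].
  have := (cI i0 i1 1 isT isT); have := cS i0 1 isT; rewrite !ck /= => cm1 cm2.
  exists (inord (c' i0 1)); first by rewrite inordK.
  case=> -[|[|i]] // hi; rewrite /c (bool_irrelevance hi isT) -/i0 -/i1.
    case=> [|[|[|v]]] //= _; rewrite ?inordK ?c0 ?ck //.
  case=> [|[|[|v]]] //= _; rewrite ?inordK ?c0 ?ck //.
  have := cI i0 i1 0 isT isT; rewrite c0; lia.
- by move=> q q' _ _ /(_ i0 1 isT) /= /val_inj.
have -> : [set q : 'I_m1.+1 | (m2 <= q) && ((cnt (tabl_of 2 (c q)) 1 == a1)
             && (cnt (tabl_of 2 (c q)) 2 == a2))] =
          [set q : 'I_m1.+1 | [&& m2 <= q, q == a1 :> nat & m1 - q + m2 == a2]].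
  apply/setP=> q; rewrite !inE; case m2q: (m2 <= q) => //=.
  rewrite !cnt_tabl_of //; try exact: gtc.
  by rewrite !big_ord_recl !big_ord0 /c /= !subn0 !addn0.
case: (boolP (_ && _)) => [/and3P[/eqP sa le2a lea1] | nab].
  have lt1 : a1 < m1.+1 by [].
  rewrite -[RHS](cards1 (Ordinal lt1)); apply: eq_card => q; rewrite !inE -val_eqE /=.
  apply/idP/idP; lia.
apply: eq_card0 => q; rewrite !inE; apply/negbTE; move: nab; apply: contra.
have := ltn_ord q; lia.
Qed.

Lemma big_nat_ord (R : Type) (idx : R) (op : Monoid.com_law idx) (m n M : nat)
    (F : nat -> R) : n <= M ->
  \big[op/idx]_(m <= i < n) F i = \big[op/idx]_(i < M | m <= i < n) F i.
Proof.
move=> nM; rewrite (big_nat_widen _ _ _ _ _ nM) big_geq_mkord.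
by apply: eq_bigl => i; rewrite andbC.
Qed.

Section Schur4.
Variables (l1 l2 l3 l4 : nat).
Hypotheses (le21 : l2 <= l1) (le32 : l3 <= l2) (le43 : l4 <= l3).
Let M := l1.+1.
Let X : finType := ('I_M * 'I_M * 'I_M * 'I_M * 'I_M * 'I_M)%type.
Let la := [:: l1; l2; l3; l4].

Definition gt4_valid (x : X) : bool :=
  let: (k1, k2, k3, p1, p2, q) := x in
  [&& l2 <= k1 < l1.+1, l3 <= k2 < l2.+1, l4 <= k3 < l3.+1,
      k2 <= p1 < k1.+1, k3 <= p2 < k2.+1 & p2 <= q < p1.+1].

(** The [k], [p] and [q] entries are the shapes formed by the tableau entries at most 3, 2 and 1.
    The inner lists give [c i v] for [v] from 0 to 4; row [i], counted from 0, holds no tableau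
    entry below [i + 1]. *)
Definition gt4_pattern (x : X) (i : 'I_(size la)) (v : nat) : nat :=
  let: (k1, k2, k3, p1, p2, q) := x in
  nth 0 (nth [::] [:: [:: 0; val q; val p1; val k1; l1];
                      [:: 0; 0; val p2; val k2; l2];
                      [:: 0; 0; 0; val k3; l3]; [:: 0; 0; 0; 0; l4]] i) v.

Lemma gt4_sum (R : zmodType) (F : nat -> nat -> nat -> nat -> nat -> nat -> R) :
  (\sum_(l2 <= k1 < l1.+1) \sum_(l3 <= k2 < l2.+1) \sum_(l4 <= k3 < l3.+1)
   \sum_(k2 <= p1 < k1.+1) \sum_(k3 <= p2 < k2.+1) \sum_(p2 <= q < p1.+1)
     F k1 k2 k3 p1 p2 q =
   \sum_(x : X | gt4_valid x)
     let: (k1, k2, k3, p1, p2, q) := x in F k1 k2 k3 p1 p2 q)%R.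
Proof.
transitivity (\sum_(k1 < M | (l2 <= k1 < l1.+1)%N) \sum_(k2 < M | (l3 <= k2 < l2.+1)%N)
   \sum_(k3 < M | (l4 <= k3 < l3.+1)%N) \sum_(p1 < M | (k2 <= p1 < k1.+1)%N)
   \sum_(p2 < M | (k3 <= p2 < k2.+1)%N) \sum_(q < M | (p2 <= q < p1.+1)%N)
     F k1 k2 k3 p1 p2 q)%R.
  rewrite (@big_nat_ord _ _ _ _ _ M) //; apply: eq_bigr => k1 /andP[? ?].
  rewrite (@big_nat_ord _ _ _ _ _ M) //; apply: eq_bigr => k2 /andP[? ?].
  rewrite (@big_nat_ord _ _ _ _ _ M) ?ltnS ?(leq_trans le32) //.
  apply: eq_bigr => k3 /andP[? ?].
  rewrite (@big_nat_ord _ _ _ _ _ M) //; apply: eq_bigr => p1 /andP[? ?].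
  rewrite (@big_nat_ord _ _ _ _ _ M) //; apply: eq_bigr => p2 /andP[? ?].
  by rewrite (@big_nat_ord _ _ _ _ _ M).
rewrite !pair_big_dep /=; apply: eq_big => [|] [[[[[k1 k2] k3] p1] p2] q] //=.
by rewrite !andbA.
Qed.

Lemma gt4_patternP x : gt4_valid x -> gt_pattern 4 (gt4_pattern x).
Proof.
case: x => [[[[[k1 k2] k3] p1] p2] q] /= V; split.
- by case=> -[|[|[|[|i]]]].
- by case=> -[|[|[|[|i]]]].
- by case=> -[|[|[|[|i]]]] ? [|[|[|[|v]]]] //= _; lia.
- by case=> -[|[|[|[|i]]]] ? [[|[|[|[|i']]]] ?] [|[|[|[|v]]]] //= _ _; lia.
Qed.

Lemma schur_sub4_gt a1 a2 b1 b2 : schur_sub4 la a1 a2 b1 b2 =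
  #|[set x : X | gt4_valid x && (let: (k1, k2, k3, p1, p2, q) := x in
      let c1 := q : nat in let c2 := (p1 - q) + p2 in
      let c3 := (k1 - p1) + (k2 - p2) + k3 in
      let c4 := (l1 - k1) + (l2 - k2) + (l3 - k3) + l4 in
      [&& c1 + c2 == a1, c3 + c4 == a2, c1 + c3 == b1 & c2 + c4 == b2])]|.
Proof.
pose i0 := @Ordinal (size la) 0 isT; pose i1 := @Ordinal (size la) 1 isT.
pose i2 := @Ordinal (size la) 2 isT; pose i3 := @Ordinal (size la) 3 isT.
have part (i i' : nat) : i <= i' -> nth 0 la i' <= nth 0 la i.
  by case: i i' => [|[|[|[|i]]]] [|[|[|[|i']]]] //=; rewrite ?nth_nil //=; lia.
rewrite /schur_sub4 (card_ssyt part (V := gt4_valid) (c := gt4_pattern)); first last.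
- move=> c' [c0 ck cS cI].
  (* These inequalities make the triangle valid, and they force [c' i v = 0] for [v <= i], by
     interlacing down to the zero column [v = 0]. *)
  have := cS i0 1 isT; have := cS i0 2 isT; have := cS i0 3 isT.
  have := cS i1 1 isT; have := cS i1 2 isT; have := cS i1 3 isT.
  have := cS i2 1 isT; have := cS i2 2 isT; have := cS i2 3 isT.
  have := cI i0 i1 0 isT isT; have := cI i0 i1 1 isT isT.
  have := cI i0 i1 2 isT isT; have := cI i0 i1 3 isT isT.
  have := cI i1 i2 0 isT isT; have := cI i1 i2 1 isT isT.
  have := cI i1 i2 2 isT isT; have := cI i1 i2 3 isT isT.
  have := cI i2 i3 0 isT isT; have := cI i2 i3 1 isT isT.
  have := cI i2 i3 2 isT isT; have := cI i2 i3 3 isT isT.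
  rewrite !ck !c0 /= => *.
  exists (inord (c' i0 3), inord (c' i1 3), inord (c' i2 3),
          inord (c' i0 2), inord (c' i1 2), inord (c' i0 1)).
    by rewrite /= !inordK; lia.
  case=> -[|[|[|[|i]]]] // hi;
  rewrite /gt4_pattern (bool_irrelevance hi isT) -/i0 -/i1 -/i2 -/i3;
  case=> [|[|[|[|[|v]]]]] //= _; rewrite ?inordK ?c0 ?ck //; lia.
- move=> [[[[[k1 k2] k3] p1] p2] q] [[[[[k1' k2'] k3'] p1'] p2'] q'] _ _ E.
  have /val_inj-> := E i0 1 isT; have /val_inj-> := E i0 2 isT.
  have /val_inj-> := E i0 3 isT; have /val_inj-> := E i1 2 isT.
  by have /val_inj-> := E i1 3 isT; have /val_inj-> := E i2 3 isT.
- exact: gt4_patternP.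
apply: eq_card => x; rewrite !inE; case V: (gt4_valid x) => //=.
rewrite !cnt_tabl_of //; try exact: gt4_patternP.
rewrite !big_ord_recl !big_ord0 /=.
move: V; case: x => [[[[[k1 k2] k3] p1] p2] q] /= V.
by rewrite !subn0 !addn0 !addnA.
Qed.

End Schur4.

(** * Specialization at (1, y, x, xy) *)

Section Bivariate.
Local Open Scope ring_scope.

(* The outer variable of {poly {poly int}} is x, the inner one y. *)
Definition mono (a b : nat) : {poly {poly int}} := 'X^a * ('X^b)%:P.

Definition coef2 (P : {poly {poly int}}) (a b : nat) : int := P`_a`_b.

Lemma coef2_mono a b i j : coef2 (mono a b) i j = ((i == a) && (j == b))%:R.
Proof.
rewrite /coef2 /mono coefMC coefXn; case: eqP => _; rewrite ?mul0r ?coef0 //.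
by rewrite mul1r coefXn.
Qed.

Lemma mono00 : mono 0 0 = 1.
Proof. by rewrite /mono !expr0 mul1r. Qed.

Lemma coef2_sum (I : Type) (r : seq I) (Q : pred I) (F : I -> {poly {poly int}}) a b :
  coef2 (\sum_(i <- r | Q i) F i) a b = \sum_(i <- r | Q i) coef2 (F i) a b.
Proof. by rewrite /coef2 !coef_sum. Qed.

Lemma mono_mul a b a' b' : mono a b * mono a' b' = mono (a + a') (b + b').
Proof. by rewrite /mono !exprD rmorphM /=; ring. Qed.

Lemma mono_exp a b n : mono a b ^+ n = mono (a * n) (b * n).
Proof. by rewrite /mono exprMn -rmorphXn /= -!exprM. Qed.

(** At x1 = y1 = 1 the variables become 1, y, x, xy: entries 3 and 4 carry x, entries 2 and 4 carry
    y. The exponents of x1 and y1 are recovered from the size of the shape. *)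
Lemma schur_sub4_coef l1 l2 l3 l4 a1 a2 b1 b2 :
  (l2 <= l1)%N -> (l3 <= l2)%N -> (l4 <= l3)%N ->
  (a1 + a2 = l1 + l2 + l3 + l4)%N -> (b1 + b2 = l1 + l2 + l3 + l4)%N ->
  (schur_sub4 [:: l1; l2; l3; l4] a1 a2 b1 b2)%:Z =
  coef2 (schur4 (mono 0 0) (mono 0 1) (mono 1 0) (mono 1 1) l1 l2 l3 l4) a2 b2.
Proof.
move=> le21 le32 le43 Na Nb; rewrite schur_sub4_gt //.
rewrite /schur4.
under eq_bigr => k1 _ do under eq_bigr => k2 _ do under eq_bigr => k3 _ do
  (rewrite /schur3 big_distrl /=; under eq_bigr => p1 _ do
    (rewrite big_distrl /=; under eq_bigr => p2 _ do
      (rewrite /schur2 big_distrl /= big_distrl /=; under eq_bigr => q _ do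
         rewrite !mono_exp !mono_mul))).
rewrite gt4_sum // coef2_sum -sum1dep_card big_mkcondr /=.
rewrite (big_morph Posz PoszD (erefl _)).
apply: eq_bigr => -[[[[[k1 k2] k3] p1] p2] q] V; rewrite coef2_mono.
move: V; rewrite /gt4_valid => V.
case: ifP => C; case: (boolP (_ && _)) => D //; exfalso; lia.
Qed.

End Bivariate.

(** * Lattice-point counts for Fbar and p_S *)

Section LatticeCounts.
Local Open Scope ring_scope.

(* Eliminating k3 and k4 from the equations defining [Fbar_coef a b]. *)
Definition Fbar_count (K : nat) (a b : int) : nat :=
  (\sum_(k1 < K) \sum_(k2 < K)
     nat_of_bool ((0 <= a + k1%:Z - k2%:Z)%R && ((k1 + k2)%:Z <= b)%R))%N.

(** Eliminates a summation index that a linear equation fixes to be [t]; [c] collects the conditions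
    free of that index. *)
Lemma sum_eqz (K : nat) (c : bool) (t : int) (Q : nat -> bool) :
  (forall i : nat, Q i = c && (i%:Z == t)) ->
  (\sum_(i < K) nat_of_bool (Q i))%N = (c && (0 <= t < K%:Z)) :> nat.
Proof.
move=> HQ; case: (boolP (c && _)) => [/andP[ct /andP[t0 tK]] | nct].
  have lt : (`|t| < K)%N by lia.
  rewrite (bigD1 (Ordinal lt)) //= HQ ct big1 ?addn0 => [|i].
    by rewrite (_ : _ == t = true) //; lia.
  by rewrite -val_eqE /= HQ; lia.
rewrite big1 // => i _; have := ltn_ord i; rewrite HQ; lia.
Qed.

Lemma sum_ord_widen (n K : nat) (F : nat -> nat) : (n <= K)%N ->
  (forall i, (n <= i)%N -> F i = 0%N) ->
  (\sum_(i < K) F i = \sum_(i < n) F i)%N.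
Proof.
move=> nK F0; rewrite -!(big_mkord xpredT) (big_cat_nat (leq0n n) nK) /=.
by rewrite [X in (_ + X)%N]big_nat [X in (_ + X)%N]big1 ?addn0 // => i /andP[/F0].
Qed.

Lemma Fbar_count_widen (n K : nat) a b : (`|b| < n)%N -> (n <= K)%N ->
  Fbar_count K a b = Fbar_count n a b.
Proof.
move=> bn nK; rewrite /Fbar_count.
pose F k1 := (\sum_(k2 < K)
  nat_of_bool ((0 <= a + k1%:Z - k2%:Z)%R && ((k1 + k2)%:Z <= b)%R))%N.
rewrite (sum_ord_widen (F := F) nK); last first.
  by move=> i ni; apply: big1 => j _; lia.
apply: eq_bigr => k1 _.
apply: (sum_ord_widen (F := fun k2 =>
  nat_of_bool ((0 <= a + k1%:Z - k2%:Z)%R && ((k1 + k2)%:Z <= b)%R)) nK).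
by move=> i ni; lia.
Qed.

(** The equations give [k4 = b - k1 - k2] and [k3 = a + k1 - k2], and both lie within the stated
    bounds when nonnegative. Any [K] above the absolute value of [b] serves, since
    [k1 + k2 <= b]. *)
Lemma Fbar_coefE K a b : (`|b| < K)%N -> Fbar_coef a b = Fbar_count K a b.
Proof.
move=> bK; rewrite (Fbar_count_widen a (n := `|b|.+1)) // /Fbar_coef /Fbar_count.
apply: eq_bigr => k1 _; apply: eq_bigr => k2 _.
under eq_bigr => k3 _.
  rewrite (@sum_eqz _ (- k1%:Z + k2%:Z + k3%:Z == a) (b - k1%:Z - k2%:Z)
    (fun k4 => ((- (k1%:Z) + k2%:Z + k3%:Z == a)%R && ((k1 + k2 + k4)%:Z == b)%R))).
    over.
  by move=> k4; lia.
rewrite (@sum_eqz _ (0 <= b - k1%:Z - k2%:Z < (`|b|.+1)%:Z) (a + k1%:Z - k2%:Z)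
   (fun k3 => (- k1%:Z + k2%:Z + k3%:Z == a) && (0 <= b - k1%:Z - k2%:Z < (`|b|.+1)%:Z))).
  have := ltn_ord k1; have := ltn_ord k2; lia.
by move=> k3; lia.
Qed.

(** The substitution s0 = y/x, s1 = x turns s0 s1 into y and s0 s1^2 into xy, hence the generating
    function of [pS] into Fbar. On indices it reads x1 = k1, x2 = k3, x3 = k4, x4 = k2. *)
Lemma pSE a b : pS b (a + b) = Fbar_coef a b.
Proof.
rewrite /pS; case: ifP => [neg | /negbT nneg].
  rewrite (@Fbar_coefE `|b|.+1) // /Fbar_count big1 // => k1 _; rewrite big1 // => k2 _; lia.
set K := (_ + _).+1.
rewrite (@Fbar_coefE K) /Fbar_count; last by rewrite /K; lia.
apply: eq_bigr => x1 _; rewrite exchange_big /=.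
under eq_bigr => x3 _ do rewrite exchange_big /=.
rewrite exchange_big /=; apply: eq_bigr => x4 _.
under eq_bigr => x3 _.
  rewrite (@sum_eqz _ ((x1 + x3 + x4)%:Z == b) (a + b - x3%:Z - 2%:Z * x4%:Z)
    (fun x2 => ((x1 + x3 + x4)%:Z == b) && ((x2 + x3 + 2 * x4)%:Z == a + b))).
    over.
  by move=> x2; lia.
rewrite (@sum_eqz _ (0 <= a + x1%:Z - x4%:Z < K%:Z) (b - x1%:Z - x4%:Z)
   (fun x3 => ((x1 + x3 + x4)%:Z == b) && (0 <= a + b - x3%:Z - 2%:Z * x4%:Z < K%:Z))).
  have := ltn_ord x1; have := ltn_ord x4; rewrite /K; lia.
by move=> x3; lia.
Qed.

(** Each of y/x, xy, x, y has nonnegative degree in y and nonnegative total degree. *)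
Lemma Fbar_coef_eq0 a b : (b < 0) || (a + b < 0) -> Fbar_coef a b = 0%N.
Proof.
by move=> neg; rewrite (@Fbar_coefE `|b|.+1) // /Fbar_count big1 // => k1 _;
   rewrite big1 // => k2 _; lia.
Qed.

Lemma Fbar_coef_neq0 a b : Fbar_coef a b != 0%N <-> (0 <= b) /\ (0 <= a + b).
Proof.
split=> [|[b0 ab0]].
  by move=> nz; case: (boolP ((b < 0) || (a + b < 0))) => [/Fbar_coef_eq0 E | ]; lia.
rewrite (@Fbar_coefE (`|a| + `|b|).+1) /Fbar_count; last by lia.
(* Witness: [k1] = max(0, -a) and [k2 = 0], so that [a + k1 >= 0] and [k1 <= b]. *)
pose k : nat := if 0 <= a then 0%N else `|a|%N.
have ltk : (k < (`|a| + `|b|).+1)%N by rewrite /k; case: ifP; lia.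
rewrite (bigD1 (Ordinal ltk)) //= (bigD1 ord0) //= -lt0n !addn_gt0 lt0b.
by apply/orP; left; apply/orP; left; rewrite /k; case: ifP; lia.
Qed.

(** For [b <= a] the condition [k2 <= a + k1] already follows from [k1 + k2 <= b], so [a] drops out
    of the count. *)
Lemma Fbar_coef_stable a a' b : b <= a -> b <= a' -> Fbar_coef a b = Fbar_coef a' b.
Proof.
move=> ba ba'; rewrite !(@Fbar_coefE `|b|.+1) //.
by apply: eq_bigr => k1 _; apply: eq_bigr => k2 _; lia.
Qed.

(* x^(K-1) times Fbar, with all four summation indices truncated below K. *)
Definition geom4 (K : nat) : {poly {poly int}} :=
  (\sum_(k1 < K) mono (K.-1 - k1) k1) * (\sum_(k2 < K) mono k2 k2)
  * ((\sum_(k3 < K) mono k3 0) * (\sum_(k4 < K) mono 0 k4)).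

(** The exponents are offset by the factor x^(K-1) of [geom4]; the shifts by 2 and 1 come from the
    denominator x^2 y. The bound on [K] puts the truncation out of reach of this coefficient. *)
Lemma coef2_geom4 K a b m n : (a + b + m + n + 5 <= K)%N ->
  coef2 (mono a b * geom4 K) (K + m + 1) (n + 1)
  = (Fbar_coef (m%:Z - (a%:Z - 2)) (n%:Z - (b%:Z - 1)))%:Z.
Proof.
move=> hK; rewrite (@Fbar_coefE K); last by lia.
have -> : mono a b * geom4 K = \sum_(k1 < K) \sum_(k2 < K) \sum_(k3 < K) \sum_(k4 < K)
    mono (a + (K.-1 - k1 + k2 + k3)) (b + (k1 + k2 + k4)).
  rewrite /geom4 [X in _ * (X * _)]big_distrlr [X in _ * (_ * X)]big_distrlr /=.
  rewrite big_distrl big_distrr; apply: eq_bigr => k1 _.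
  rewrite /= big_distrl big_distrr; apply: eq_bigr => k2 _.
  rewrite /= !big_distrr; apply: eq_bigr => k3 _.
  rewrite /= !big_distrr; apply: eq_bigr => k4 _.
  by rewrite /= !mono_mul addn0 add0n.
rewrite coef2_sum (big_morph Posz PoszD (erefl _)); apply: eq_bigr => k1 _.
rewrite coef2_sum (big_morph Posz PoszD (erefl _)); apply: eq_bigr => k2 _.
rewrite coef2_sum.
have ltk1 := ltn_ord k1; have ltk2 := ltn_ord k2.
transitivity ((\sum_(k3 < K) \sum_(k4 < K) nat_of_bool
   ((k3%:Z == m%:Z + 2 - a%:Z + k1%:Z - k2%:Z)
    && (k4%:Z == n%:Z + 1 - b%:Z - k1%:Z - k2%:Z))%R)%N%:Z).
  rewrite (big_morph Posz PoszD (erefl _)); apply: eq_bigr => k3 _.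
  rewrite coef2_sum (big_morph Posz PoszD (erefl _)); apply: eq_bigr => k4 _.
  rewrite coef2_mono natz; congr (Posz (nat_of_bool _)); lia.
congr Posz; under eq_bigr => k3 _.
  rewrite (@sum_eqz _ (k3%:Z == m%:Z + 2 - a%:Z + k1%:Z - k2%:Z)
    (n%:Z + 1 - b%:Z - k1%:Z - k2%:Z)
    (fun k4 => (k3%:Z == m%:Z + 2 - a%:Z + k1%:Z - k2%:Z)
               && (k4%:Z == n%:Z + 1 - b%:Z - k1%:Z - k2%:Z)));
    last by [].
  over.
rewrite (@sum_eqz _ (0 <= n%:Z + 1 - b%:Z - k1%:Z - k2%:Z < K%:Z)
   (m%:Z + 2 - a%:Z + k1%:Z - k2%:Z)
   (fun k3 => (k3%:Z == m%:Z + 2 - a%:Z + k1%:Z - k2%:Z)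
      && (0 <= n%:Z + 1 - b%:Z - k1%:Z - k2%:Z < K%:Z))).
  lia.
by move=> k3; rewrite andbC.
Qed.

End LatticeCounts.

(** * Coefficients of the alternant times truncated geometric series *)

Section AlternantCoefficients.
Local Open Scope ring_scope.
Implicit Types P Q : {poly {poly int}}.

Lemma coef2D P Q i j : coef2 (P + Q) i j = coef2 P i j + coef2 Q i j.
Proof. by rewrite /coef2 !coefD. Qed.

Lemma coef2N P i j : coef2 (- P) i j = - coef2 P i j.
Proof. by rewrite /coef2 !coefN. Qed.

Lemma coef2_mono_mul P a b i j : coef2 (mono a b * P) i j =
  if (a <= i)%N && (b <= j)%N then coef2 P (i - a) (j - b) else 0.
Proof.
rewrite /coef2 /mono -mulrA coefXnM ltnNge; case: leqP => _ /=; last by rewrite coef0.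
by rewrite coefCM coefXnM ltnNge; case: leqP.
Qed.

Lemma mono_prod4 (p q r t : nat) :
  mono 0 0 ^+ p * mono 0 1 ^+ q * mono 1 0 ^+ r * mono 1 1 ^+ t =
  mono (r + t) (q + t).
Proof. by rewrite !mono_exp !mono_mul !mul0n !mul1n !addn0 !add0n. Qed.

Lemma coef2_alt4 P (f : nat -> nat -> int) (a b c d i j : nat) :
  (forall p q, coef2 (mono p q * P) i j = f p q) ->
  coef2 (alt4 (mono 0 0) (mono 0 1) (mono 1 0) (mono 1 1) a b c d * P) i j =
  f (c + d)%N (b + d)%N - f (d + c)%N (b + c)%N - f (b + d)%N (c + d)%N + f (d
  + b)%N (c + b)%N + f (b + c)%N (d + c)%N - f (c + b)%N (d + b)%N - f (c +
  d)%N (a + d)%N + f (d + c)%N (a + c)%N + f (a + d)%N (c + d)%N - f (d + a)%N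
  (c + a)%N - f (a + c)%N (d + c)%N + f (c + a)%N (d + a)%N + f (b + d)%N (a +
  d)%N - f (d + b)%N (a + b)%N - f (a + d)%N (b + d)%N + f (d + a)%N (b + a)%N
  + f (a + b)%N (d + b)%N - f (b + a)%N (d + a)%N - f (b + c)%N (a + c)%N + f
  (c + b)%N (a + b)%N + f (a + c)%N (b + c)%N - f (c + a)%N (b + a)%N - f (a +
  b)%N (c + b)%N + f (b + a)%N (c + a)%N.
Proof.
move=> fE.
have fD A B : coef2 ((A + B) * P) i j = coef2 (A * P) i j + coef2 (B * P) i j.
  by rewrite mulrDl coef2D.
have fB A B : coef2 ((A - B) * P) i j = coef2 (A * P) i j - coef2 (B * P) i j.
  by rewrite mulrBl coef2D coef2N.
have fm p q r t :
    coef2 (mono 0 0 ^+ p * mono 0 1 ^+ q * mono 1 0 ^+ r * mono 1 1 ^+ t * P) i j =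
    f (r + t)%N (q + t)%N by rewrite mono_prod4 fE.
by rewrite alt4E; cbv zeta beta; rewrite !(fB, fD) !fm.
Qed.

Lemma geom4E K : (0 < K)%N ->
  (mono 1 0 - mono 0 1) * (mono 0 0 - mono 1 1) * (mono 0 0 - mono 1 0)
    * (mono 0 0 - mono 0 1) * geom4 K =
  (mono K 0 - mono 0 K) * (1 - mono K K) * (1 - mono K 0) * (1 - mono 0 K).
Proof.
move=> K0.
have geom a b : (1 - mono a b) * (\sum_(k < K) mono (a * k) (b * k)) =
    1 - mono (a * K) (b * K).
  rewrite -mono_exp -opprB -[RHS]opprB subrX1 mulNr; congr (- (_ * _)).
  by apply: eq_bigr => k _; rewrite mono_exp.
have g1 : (mono 1 0 - mono 0 1) * (\sum_(k < K) mono (K.-1 - k) k) =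
    mono K 0 - mono 0 K.
  have -> : mono K 0 = mono 1 0 ^+ K by rewrite mono_exp mul1n mul0n.
  have -> : mono 0 K = mono 0 1 ^+ K by rewrite mono_exp mul1n mul0n.
  rewrite subrXX; congr (_ * _); apply: eq_bigr => k _.
  rewrite !mono_exp mono_mul !mul0n !mul1n addn0 add0n; congr mono.
have g2 := geom 1 1; have g3 := geom 1 0; have g4 := geom 0 1.
move: g2 g3 g4; rewrite !mul0n !mul1n.
under eq_bigr do rewrite !mul1n; move=> g2.
under eq_bigr do rewrite !mul1n mul0n; move=> g3.
under eq_bigr do rewrite !mul1n mul0n; move=> g4.
rewrite -g1 -g2 -g3 -g4 mono00 /geom4; ring.
Qed.

(** Meant for [u] = x^K and [v] = y^K. At (1, y, x, xy) the Vandermonde product is -xy(1-x)(1-y)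
    times (x-y)(1-xy)(1-x)(1-y). The right side is sorted so that every term but the first carries
    u^2 or v. *)
Lemma vandermonde4_geom (R : comNzRingType) (x y u v s G : R) :
  (x - y) * (1 - x * y) * (1 - x) * (1 - y) * G
    = (u - v) * (1 - u * v) * (1 - u) * (1 - v) ->
  (1 - y) * (1 - x) * (y - x) * (1 - x * y) * (y - x * y) * (x - x * y) * s * G =
  - (x * y * u * ((1 - x) * (1 - y) * s)) + x * y * u * u * ((1 - x) * (1 - y) * s)
  - v * ((1 - u) * (u ^+ 2 * v - u ^+ 2 - u - 1 + v + u * v - u * v ^+ 2)
         * (x * y * ((1 - x) * (1 - y) * s))).
Proof.
move=> E.
transitivity (- (x * y * ((1 - x) * (1 - y) * s))
              * ((x - y) * (1 - x * y) * (1 - x) * (1 - y) * G)); first by ring.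
by rewrite E; ring.
Qed.

Lemma coef2_schur4 l1 l2 l3 l4 m2 n2 K :
  (l2 <= l1)%N -> (l3 <= l2)%N -> (l4 <= l3)%N ->
  (m2 + n2 + 2 <= K)%N ->
  let s := schur4 (mono 0 0) (mono 0 1) (mono 1 0) (mono 1 1) l1 l2 l3 l4 in
  coef2 ((mono 0 0 - mono 1 0) * (mono 0 0 - mono 0 1) * s) m2 n2 =
  - coef2 (alt4 (mono 0 0) (mono 0 1) (mono 1 0) (mono 1 1) l1.+3 l2.+2 l3.+1 l4
         * geom4 K) (K + m2 + 1) (n2 + 1).
Proof.
move=> le21 le32 le43 hK s.
rewrite -(schur4_alt _ _ _ _ le21 le32 le43) -/s.
have m11 : mono 1 1 = mono 1 0 * mono 0 1 by rewrite mono_mul.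
have mKK : mono K K = mono K 0 * mono 0 K by rewrite mono_mul addn0.
have K0 : (0 < K)%N by lia.
have := geom4E K0; rewrite mono00 m11 mKK => /(vandermonde4_geom s) ->.
rewrite !coef2D !coef2N !mono_mul !coef2_mono_mul.
(* The term with u^2 has x-degree at least 2K + 1 and the term with v has y-degree at least K, both
   beyond the monomial read off; only the first term remains. *)
rewrite (_ : (_ <= K + m2 + 1)%N && (_ <= n2 + 1)%N = true); last by lia.
rewrite (_ : (1 + 0 + K + K <= K + m2 + 1)%N = false); last by lia.
rewrite (_ : (K <= n2 + 1)%N = false); last by lia.
by rewrite !andbF /= addr0 subr0 opprK; congr coef2; lia.
Qed.

Lemma coef2_schur4_PF l1 l2 l3 l4 m1 m2 n1 n2 :
  (l2 <= l1)%N -> (l3 <= l2)%N -> (l4 <= l3)%N -> (m2 <= m1)%N -> (n2 <= n1)%N ->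
  (l1 + l2 + l3 + l4 = m1 + m2)%N -> (m1 + m2 = n1 + n2)%N -> (n2 <= m2)%N ->
  coef2 ((mono 0 0 - mono 1 0) * (mono 0 0 - mono 0 1)
    * schur4 (mono 0 0) (mono 0 1) (mono 1 0) (mono 1 1) l1 l2 l3 l4) m2 n2
  = PF_coef l1 l2 l3 l4 m2%:Z n2%:Z.
Proof.
move=> le21 le32 le43 lem len sl smn nm.
(* Each exponent of the alternant is at most l1 + 3, so p + q <= 4 l1 + 12 for each monomial x^p
   y^q; [coef2_geom4] asks for m2 + n2 + 5 more. *)
pose K := (4 * l1 + m2 + n2 + 17)%N.
rewrite (@coef2_schur4 _ _ _ _ _ _ K) //; last by rewrite /K; lia.
pose F (p q : nat) := (Fbar_coef (m2%:Z - (p%:Z - 2)) (n2%:Z - (q%:Z - 1)))%:Z.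
have vanish (p q : nat) : (n2 + 1 < q)%N || (m2 + n2 + 3 < p + q)%N -> F p q = 0.
  by move=> pq; rewrite /F Fbar_coef_eq0 //; lia.
(* The hypothesis [n2 <= m2] places both first arguments of [Fbar_coef] in the stable range. *)
have stable (p q p' : nat) : (p <= q + 1)%N -> (p' <= q + 1)%N -> F p q = F p' q.
  by move=> pq p'q; rewrite /F; congr Posz; apply: Fbar_coef_stable; lia.
have shift (p q : nat) (u v : int) : u = p%:Z - 2 -> v = q%:Z - 1 ->
    F p q = (Fbar_coef (m2%:Z - u) (n2%:Z - v))%:Z by move=> -> ->.
pose f (p q : nat) := coef2 (mono p q * geom4 K) (K + m2 + 1) (n2 + 1).
rewrite (@coef2_alt4 _ f) //.
have fF (p q : nat) : (p + q <= 4 * l1 + 12)%N -> f p q = F p q.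
  by move=> pq; rewrite /f coef2_geom4 // /K; lia.
clearbody f F; clear K.
rewrite !fF; [|lia..].
(* With N the common size, n2 <= N/2 and m2 + n2 <= N. In each of these thirteen monomials either q
   exceeds N/2 + 1 or p + q exceeds N + 3. *)
rewrite (vanish (l4 + l3.+1)%N (l1.+3 + l3.+1)%N); last by lia.
rewrite (vanish (l4 + l1.+3)%N (l3.+1 + l1.+3)%N); last by lia.
rewrite (vanish (l3.+1 + l1.+3)%N (l4 + l1.+3)%N); last by lia.
rewrite (vanish (l4 + l2.+2)%N (l1.+3 + l2.+2)%N); last by lia.
rewrite (vanish (l4 + l1.+3)%N (l2.+2 + l1.+3)%N); last by lia.
rewrite (vanish (l1.+3 + l2.+2)%N (l4 + l2.+2)%N); last by lia.
rewrite (vanish (l2.+2 + l1.+3)%N (l4 + l1.+3)%N); last by lia.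
rewrite (vanish (l2.+2 + l3.+1)%N (l1.+3 + l3.+1)%N); last by lia.
rewrite (vanish (l3.+1 + l2.+2)%N (l1.+3 + l2.+2)%N); last by lia.
rewrite (vanish (l1.+3 + l3.+1)%N (l2.+2 + l3.+1)%N); last by lia.
rewrite (vanish (l3.+1 + l1.+3)%N (l2.+2 + l1.+3)%N); last by lia.
rewrite (vanish (l1.+3 + l2.+2)%N (l3.+1 + l2.+2)%N); last by lia.
rewrite (vanish (l2.+2 + l1.+3)%N (l3.+1 + l1.+3)%N); last by lia.
(* The seven terms of P_lambda, with exponents lowered by 2 in x and by 1 in y. *)
rewrite (shift (l3.+1 + l4)%N (l2.+2 + l4)%N (l3%:Z + l4%:Z - 1) (l2 + l4 + 1)%N%:Z); [|lia..].
rewrite (shift (l2.+2 + l4)%N (l3.+1 + l4)%N (l2 + l4)%N%:Z (l3 + l4)%N%:Z); [|lia..].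
rewrite (shift (l2.+2 + l3.+1)%N (l4 + l3.+1)%N (l2 + l3 + 1)%N%:Z (l3 + l4)%N%:Z); [|lia..].
rewrite (shift (l3.+1 + l2.+2)%N (l4 + l2.+2)%N (l2 + l3 + 1)%N%:Z (l2 + l4 + 1)%N%:Z); [|lia..].
rewrite (shift (l1.+3 + l4)%N (l3.+1 + l4)%N (l1 + l4 + 1)%N%:Z (l3 + l4)%N%:Z); [|lia..].
rewrite (shift (l1.+3 + l3.+1)%N (l4 + l3.+1)%N (l1 + l3 + 2)%N%:Z (l3 + l4)%N%:Z); [|lia..].
rewrite (shift (l1.+3 + l4)%N (l2.+2 + l4)%N (l1 + l4 + 1)%N%:Z (l2 + l4 + 1)%N%:Z); [|lia..].
(* The last four terms form two pairs of opposite sign and equal y-exponent. *)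
rewrite (stable (l3.+1 + l4)%N (l1.+3 + l4)%N (l2.+2 + l4)%N); [|lia..].
rewrite (stable (l4 + l3.+1)%N (l2.+2 + l3.+1)%N (l4 + l2.+2)%N); [|lia..].
rewrite (addnC l2.+2).
by rewrite /PF_coef /P_terms !big_cons big_nil /=; ring.
Qed.

End AlternantCoefficients.

(** * Kronecker coefficients as mixed differences *)

Section Kronecker.
Local Open Scope ring_scope.

(** For a2 <= a1, the coefficient in s_(m1,m2) is 1 exactly when the sizes agree and m2 <= a2, and 0
    otherwise; the double sum collapses to one over the second part. *)
Lemma sum_schur_coef2 (F : nat -> nat -> int) (a1 a2 : nat) : (a2 <= a1)%N ->
  \sum_(m1 < (a1 + a2).+1) \sum_(m2 < (a1 + a2).+1 | (m2 <= m1)%N)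
    F m1 m2 * (schur_coef2 [:: nat_of_ord m1; nat_of_ord m2] a1 a2)%:Z
  = \sum_(i < a2.+1) F (a1 + a2 - i)%N i.
Proof.
move=> le21; set N := (a1 + a2)%N; have defN : N = (a1 + a2)%N by [].
have a2N : (a2.+1 <= N.+1)%N by rewrite /N; lia.
rewrite (exchange_big_dep xpredT) //=.
rewrite -(big_ord_narrow (F := fun i : 'I_N.+1 => F (N - i)%N i) a2N) [RHS]big_mkcond.
apply: eq_bigr => m2 _; have ltm2 := ltn_ord m2.
rewrite (eq_bigr (fun m1 : 'I_N.+1 => if (m2 < a2.+1)%N && ((m1 + m2)%N == N)
          then F m1 m2 else 0)); last first.
  move=> m1 le; rewrite schur_coef2E // -/N eq_sym.
  have -> : (m1 + m2 == N)%N && (m2 <= a1 <= m1)%N = (m2 < a2.+1)%N && (m1 + m2 == N)%N.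
    by lia.
  by case: ifP; rewrite ?mulr1 ?mulr0.
case: ifP => lem2 /=; last by rewrite big1.
have ltN : (N - m2 < N.+1)%N by lia.
rewrite (bigD1 (Ordinal ltN)) /=; last by lia.
rewrite ifT; last by lia.
rewrite big1 ?addr0 // => m1 /andP[_]; rewrite -val_eqE /= => ne.
by rewrite ifF //; lia.
Qed.

Lemma kron_expansion_sum la g a1 a2 b1 b2 : kron_expansion la g ->
  (a2 <= a1)%N -> (b2 <= b1)%N ->
  (schur_sub4 la a1 a2 b1 b2)%:Z =
  \sum_(i < a2.+1) \sum_(j < b2.+1) g (a1 + a2 - i)%N i (b1 + b2 - j)%N j.
Proof.
move=> kg lea leb; rewrite kg.
rewrite -(sum_schur_coef2 (fun m1 m2 => \sum_(j < b2.+1) g m1 m2 (b1 + b2 - j)%N j) lea).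
apply: eq_bigr => m1 _; apply: eq_bigr => m2 _.
rewrite -(sum_schur_coef2 (g m1 m2) leb) big_distrl; apply: eq_bigr => n1 _ /=.
rewrite big_distrl; apply: eq_bigr => n2 _ /=.
by rewrite PoszM -mulrA [X in _ * X]mulrC.
Qed.

(** The coefficients of the specialized Schur polynomial are cumulative sums of [g] over the second
    parts; multiplying by (1-x)(1-y) takes their mixed difference, which leaves one value. *)
Lemma kron_coef2 l1 l2 l3 l4 m1 m2 n1 n2 g :
  (l2 <= l1)%N -> (l3 <= l2)%N -> (l4 <= l3)%N -> (m2 <= m1)%N -> (n2 <= n1)%N ->
  (l1 + l2 + l3 + l4 = m1 + m2)%N -> (m1 + m2 = n1 + n2)%N ->
  kron_expansion [:: l1; l2; l3; l4] g ->
  g m1 m2 n1 n2 =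
  coef2 ((mono 0 0 - mono 1 0) * (mono 0 0 - mono 0 1)
    * schur4 (mono 0 0) (mono 0 1) (mono 1 0) (mono 1 1) l1 l2 l3 l4) m2 n2.
Proof.
move=> le21 le32 le43 lem len sl smn kg; set s := schur4 _ _ _ _ _ _ _ _.
pose N := (m1 + m2)%N.
(* Strict bounds make [B] vanish at 0, which matches the absent coefficients when [m2] or [n2] is
   0. *)
pose B a b := \sum_(i < a) \sum_(j < b) g (N - i)%N i (N - j)%N j.
have sB a b : (a <= m2)%N -> (b <= n2)%N -> coef2 s a b = B a.+1 b.+1.
  move=> am bn; rewrite -(@schur_sub4_coef _ _ _ _ (N - a) a (N - b) b) // /N; [|lia..].
  rewrite (kron_expansion_sum kg); [|lia..].
  by rewrite /B /N !subnK //; lia.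
have -> : (mono 0 0 - mono 1 0) * (mono 0 0 - mono 0 1) * s =
    mono 0 0 * s - mono 1 0 * s - mono 0 1 * s + mono 1 1 * s.
  have -> : mono 1 1 = mono 1 0 * mono 0 1 by rewrite mono_mul.
  rewrite mono00.
  by ring.
have B0l b : B 0%N b = 0 by rewrite /B big_ord0.
have B0r a : B a 0%N = 0 by rewrite /B big1 // => i _; rewrite big_ord0.
have -> : coef2 (mono 0 0 * s - mono 1 0 * s - mono 0 1 * s + mono 1 1 * s) m2 n2 =
    B m2.+1 n2.+1 - B m2 n2.+1 - B m2.+1 n2 + B m2 n2.
  rewrite !(coef2D, coef2N) !coef2_mono_mul /= !subn0 (sB m2 n2) // !andbT.
  congr (_ - _ - _ + _).
  - case: (posnP m2) => [-> | m0]; first by rewrite B0l.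
    by rewrite sB ?subn1 ?prednK //; lia.
  - case: (posnP n2) => [-> | n0]; first by rewrite B0r.
    by rewrite sB ?subn1 ?prednK //; lia.
  - case: (posnP m2) => [-> | m0]; first by rewrite B0l.
    case: (posnP n2) => [-> | n0]; first by rewrite B0r.
    by rewrite sB ?subn1 ?prednK //; lia.
have BS a b : B a.+1 b = B a b + \sum_(j < b) g (N - a)%N a (N - j)%N j.
  by rewrite /B big_ord_recr.
rewrite !BS (big_ord_recr n2) /= /N addnK smn addnK; ring.
Qed.

End Kronecker.

Theorem theorem3p3 (l1 l2 l3 l4 m1 m2 n1 n2 : nat)
  (g : nat -> nat -> nat -> nat -> int) :
  l2 <= l1 -> l3 <= l2 -> l4 <= l3 -> m2 <= m1 -> n2 <= n1 ->
  l1 + l2 + l3 + l4 = m1 + m2 -> m1 + m2 = n1 + n2 ->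
  n2 <= m2 ->
  kron_expansion [:: l1; l2; l3; l4] g ->
  (g m1 m2 n1 n2 = PF_coef l1 l2 l3 l4 m2%:Z n2%:Z /\
   (forall t, t \in P_terms l1 l2 l3 l4 ->
      (Fbar_coef (m2%:Z - t.1.2)%R (n2%:Z - t.2)%R != 0 <->
       ((t.2 <= n2%:Z)%R /\ (t.1.2 + t.2 <= (m2 + n2)%:Z)%R))))
  /\
  let A : int := (n2%:Z - (l3 + l4)%:Z)%R in
  let B : int := (n2%:Z - (l2 + l4 + 1)%:Z)%R in
  g m1 m2 n1 n2 =
    ((pS A (A + m2%:Z - (l2 + l4)%:Z))%:Z
     - (pS A (A + m2%:Z - (l2 + l3 + 1)%:Z))%:Z
     - (pS A (A + m2%:Z - (l1 + l4 + 1)%:Z))%:Z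
     + (pS A (A + m2%:Z - (l1 + l3 + 2)%:Z))%:Z
     - (pS B (B + m2%:Z - (l3%:Z + l4%:Z - 1)))%:Z
     + (pS B (B + m2%:Z - (l2 + l3 + 1)%:Z))%:Z
     + (pS B (B + m2%:Z - (l1 + l4 + 1)%:Z))%:Z)%R.
Proof.
move=> le21 le32 le43 lem len sl smn nm kg.
have gPF : g m1 m2 n1 n2 = PF_coef l1 l2 l3 l4 m2%:Z n2%:Z.
  by rewrite (kron_coef2 _ _ _ _ _ _ _ kg) // (coef2_schur4_PF (m1 := m1) (n1 := n1)).
split; [split=> // t _ | move=> A B].
  rewrite Fbar_coef_neq0; split; lia.
have pSF (c u : int) : pS c (c + m2%:Z - u)%R = Fbar_coef (m2%:Z - u)%R c.
  by rewrite -pSE; congr pS; ring.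
rewrite gPF /PF_coef /P_terms !big_cons big_nil /= !pSF /A /B.
by ring.
Qed.
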